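(* Let $\mathcal{P}_h$ denote the family of strongly asymmetric graphs on $h$ vertices, and let $H \sim G(h,1/2)$. Then $$\Pr[H \in \mathcal{P}_h] = 1 - o_h(1),$$ i.e. the probability that $H$ is strongly asymmetric tends to $1$ as $h \to \infty$.
   Context: All graphs are finite and simple; $[h]=\{1,\dots,h\}$; all logarithms are base $2$; $H[S]$ is the subgraph of $H$ induced by $S$. $G(h,1/2)$ is the random graph on vertex set $[h]$ in which each pair of vertices is an edge independently with probability $1/2$. **Blowups.** For a graph $F$ with vertices $v_1,\dots,v_s$ and positive integers $a_1,\dots,a_s$, the blowup $F(a_1,\dots,a_s)$ has as vertex set the disjoint union of independent sets (parts) $A_1,\dots,A_s$ with $|A_i|=a_i$; for $i\ne j$, all pairs between $A_i$ and $A_j$ are edges if $v_iv_j\in E(F)$, and none are edges otherwise. A pair of distinct vertices of a blowup is a part pair if both lie in the same part, and a blowup pair otherwise. Changing a pair means turning an edge into a non-edge or vice versa. **Closeness.** Let $B$ be a blowup of some graph and $B'$ a graph of the same order. $B$ is blowup $m$-close to $B'$ if one can change at most $m$ blowup pairs of $B$ and arbitrarily change part pairs of $B$ so that the resulting graph is isomorphic to $B'$; otherwise it is blowup $m$-far from $B'$. For graphs $H_1,H_2$ of the same order and a bijection $\pi:V(H_1)\to V(H_2)$, $\pi$ is $m$-close to an isomorphism between $H_1$ and $H_2$ if one can change at most $m$ pairs of $H_1$ so that $\pi$ is an isomorphism from the obtained graph to $H_2$; otherwise $\pi$ is $m$-far from an isomorphism. A stationary point of $\pi$ is a vertex $v$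 with $\pi(v)=v$. **Agreement and distinguishing sets.** For $S\subset V(H)$, the agreement set $A(S)$ is the set of vertices $w\in V(H)\setminus S$ that are either adjacent to all vertices of $S$ or non-adjacent to all vertices of $S$. A set $Q\subset V(H)$ is distinguishing if $Q$ is not contained in the agreement set of any two vertices outside $Q$. **Strongly asymmetric graphs.** A graph $H$ on vertex set $[h]$ is strongly asymmetric ($H\in\mathcal{P}_h$) if all of the following hold: 1. Every vertex degree is larger than $0.4h$ and smaller than $0.6h$. 2. The agreement set of every pair of vertices has order at most $0.55h$, and the agreement set of every triple of vertices has order at most $0.3h$. 3. $H$ has a distinguishing set of order at most $3\log h$. 4. For every $S\subset[h]$ with $|S|\le 0.7h$, every blowup $B$ of $H[S]$ with at least $0.8h$ and at most $h$ vertices in which each part has at most $h/100$ vertices, and every $K\subseteq[h]$ (with $|K|=|V(B)|$, as needed for the comparison), $B$ is blowup $10^{-5}h^2$-far from $H[K]$. 5. For all $J,K\subset[h]$ with $|J|=|K|=\lceil 0.7h\rceil$ and every bijection $\pi:J\to K$ with at least $0.1h$ non-stationary points, $\pi$ is $10^{-5}h^2$-far from an isomorphism between $H[J]$ and $H[K]$. *)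

(* Defs.v *)
From HB Require Import structures.
From mathcomp Require Import all_boot all_order all_algebra.
From mathcomp Require Import all_classical all_reals all_analysis.

Set Implicit Arguments.
Unset Strict Implicit.
Unset Printing Implicit Defensive.

Import Order.TTheory GRing.Theory Num.Theory.
Local Open Scope ring_scope.

(* A finite simple graph on the vertex type T is its set of edges, an edge    *)
(* being a two-element set of vertices.                                       *)
Definition sgraph (T : finType) :=
  {E : {set {set T}} | [forall e in E, #|e| == 2%N]}.

Section Graphs.
Variable T : finType.
Implicit Types (H : sgraph T) (S Q : {set T}).

Definition edges H : {set {set T}} := val H.

Definition adj H : rel T := fun x y => [set x; y] \in edges H.

Lemma card_edge H (e : {set T}) : e \in edges H -> #|e| = 2%N.
Proof. by move=> eH; apply/eqP; move/forall_inP: (valP H); apply. Qed.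

Lemma adj_sym H : symmetric (adj H).
Proof. by move=> x y; rewrite /adj finset.setUC. Qed.

Lemma adj_irr H : irreflexive (adj H).
Proof.
by move=> x; apply/negP=> /card_edge; rewrite finset.setUid cards1.
Qed.

(* Only meant for a symmetric r, see adj_graph_of below. *)
Definition edges_of (r : rel T) : {set {set T}} :=
  [set e : {set T} | (#|e| == 2%N) &&
     [forall x in e, forall y in e, (x != y) ==> r x y]].

Fact edges_ofP (r : rel T) : [forall e in edges_of r, #|e| == 2%N].
Proof. by apply/forall_inP=> e; rewrite inE => /andP[]. Qed.

Definition graph_of (r : rel T) : sgraph T :=
  exist (fun E : {set {set T}} => [forall e in E, #|e| == 2%N])
    (edges_of r) (edges_ofP r).

Lemma adj_graph_of (r : rel T) : symmetric r ->
  forall x y, adj (graph_of r) x y = (x != y) && r x y.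
Proof.
move=> r_sym x y; rewrite /adj /edges /= inE cards2.
case: (eqVneq x y) => //= nxy; apply/forall_inP/idP => [|rxy u].
  move=> /(_ x); rewrite !inE eqxx => /(_ isT)/forall_inP/(_ y).
  by rewrite !inE eqxx orbT nxy; apply.
rewrite !inE => /orP[]/eqP->; apply/forall_inP=> v.
  by rewrite !inE => /orP[]/eqP->; rewrite ?eqxx ?nxy.
by rewrite !inE => /orP[]/eqP->; rewrite ?eqxx // r_sym rxy implybT.
Qed.

Definition degree H (v : T) : nat := #|[set w | adj H v w]|.

Definition agreement H S : {set T} :=
  [set w | (w \notin S) &&
     ([forall v in S, adj H w v] || [forall v in S, ~~ adj H w v])].

Definition distinguishing H Q : Prop :=
  forall x y : T, x \notin Q -> y \notin Q -> x != y ->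
    ~~ (Q \subset agreement H [set x; y]).

Definition changed H1 H2 : {set {set T}} :=
  [set e | (e \in edges H1) != (e \in edges H2)].

End Graphs.

Definition induced_graph (T : finType) (H : sgraph T) (S : {set T}) :
  sgraph {x : T | x \in S} :=
  graph_of (fun u v : {x : T | x \in S} => adj H (val u) (val v)).

Lemma adj_induced_graph (T : finType) (H : sgraph T) (S : {set T}) u v :
  adj (induced_graph H S) u v = adj H (val u) (val v).
Proof.
rewrite adj_graph_of => [|x y]; last exact: adj_sym.
by case: eqVneq => //= ->; rewrite adj_irr.
Qed.

Definition is_iso (T1 T2 : finType) (H1 : sgraph T1) (H2 : sgraph T2)
    (f : T1 -> T2) : Prop :=
  bijective f /\ forall x y, adj H2 (f x) (f y) = adj H1 x y.

Definition isomorphic (T1 T2 : finType) (H1 : sgraph T1) (H2 : sgraph T2) :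
  Prop := exists f : T1 -> T2, is_iso H1 H2 f.

Section Blowups.
Variables (V : finType) (F : sgraph V) (a : V -> nat).

(* The part of i : V is the set of u with tag u = i, and it has a i elements. *)
Definition blowup_vertex := {i : V & 'I_(a i)}.

Definition blowup : sgraph blowup_vertex :=
  graph_of (fun u v : blowup_vertex => adj F (tag u) (tag v)).

Lemma adj_blowup u v : adj blowup u v = adj F (tag u) (tag v).
Proof.
rewrite adj_graph_of => [|x y]; last exact: adj_sym.
by case: eqVneq => //= ->; rewrite adj_irr.
Qed.

Definition part_pair (e : {set blowup_vertex}) : bool :=
  (#|e| == 2%N) && [forall u in e, forall v in e, tag u == tag v].

Definition blowup_pair (e : {set blowup_vertex}) : bool :=
  (#|e| == 2%N) && ~~ part_pair e.

(* The parts belong to the data: closeness is a property of F, a and B',      *)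
(* rather than of the graph blowup F a alone.                                 *)
Definition blowup_close (R : realType) (m : R) (W : finType)
    (B' : sgraph W) : Prop :=
  exists B1 : sgraph blowup_vertex,
    #|[set e in changed blowup B1 | blowup_pair e]|%:R <= m /\
    isomorphic B1 B'.

Definition blowup_far (R : realType) (m : R) (W : finType)
    (B' : sgraph W) : Prop := ~ blowup_close m B'.

End Blowups.

Definition iso_close (R : realType) (m : R) (T1 T2 : finType)
    (H1 : sgraph T1) (H2 : sgraph T2) (f : T1 -> T2) : Prop :=
  exists H : sgraph T1, #|changed H1 H|%:R <= m /\ is_iso H H2 f.

Definition iso_far (R : realType) (m : R) (T1 T2 : finType)
    (H1 : sgraph T1) (H2 : sgraph T2) (f : T1 -> T2) : Prop :=
  ~ iso_close m H1 H2 f.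

Definition nonstationary (T : finType) (J K : {set T})
    (f : {x : T | x \in J} -> {x : T | x \in K}) : {set {x : T | x \in J}} :=
  [set v | val (f v) != val v].

Definition log2 (R : realType) (x : R) : R := ln x / ln 2.

Section StronglyAsymmetric.
Variables (R : realType) (h : nat) (H : sgraph 'I_h).
Let n : R := h%:R.

Definition balanced_degrees : Prop :=
  forall v : 'I_h, 4 / 10 * n < (degree H v)%:R < 6 / 10 * n.

Definition small_agreement : Prop :=
  (forall S : {set 'I_h}, #|S| = 2%N ->
     #|agreement H S|%:R <= 55 / 100 * n) /\
  (forall S : {set 'I_h}, #|S| = 3%N ->
     #|agreement H S|%:R <= 3 / 10 * n).

Definition small_distinguishing_set : Prop :=
  exists Q : {set 'I_h}, distinguishing H Q /\ #|Q|%:R <= 3 * log2 n.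

Definition far_from_blowups : Prop :=
  forall (S : {set 'I_h}) (a : {x : 'I_h | x \in S} -> nat) (K : {set 'I_h}),
    #|S|%:R <= 7 / 10 * n ->
    (forall i, (0 < a i)%N) ->
    8 / 10 * n <= #|{: blowup_vertex a}|%:R <= n ->
    (forall i, (a i)%:R <= n / 100) ->
    #|K| = #|{: blowup_vertex a}| ->
    blowup_far (induced_graph H S) a (10 ^- 5 * n ^+ 2) (induced_graph H K).

Definition far_from_isomorphisms : Prop :=
  forall (J K : {set 'I_h}) (f : {x : 'I_h | x \in J} -> {x : 'I_h | x \in K}),
    #|J|%:Z = Num.ceil (7 / 10 * n) ->
    #|K|%:Z = Num.ceil (7 / 10 * n) ->
    bijective f ->
    1 / 10 * n <= #|nonstationary f|%:R ->
    iso_far (10 ^- 5 * n ^+ 2) (induced_graph H J) (induced_graph H K) f.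

Definition strongly_asymmetric : Prop :=
  [/\ balanced_degrees, small_agreement, small_distinguishing_set,
      far_from_blowups & far_from_isomorphisms].

End StronglyAsymmetric.

(* The law of G(h, p): every two-element set of vertices is an edge with      *)
(* probability p, independently.                                              *)
Definition Gnp (R : realType) (h : nat) (p : R) (H : sgraph 'I_h) : R :=
  \prod_(e : {set 'I_h} | #|e| == 2%N) (if e \in edges H then p else 1 - p).

Definition Pr_Gnp (R : realType) (h : nat) (p : R)
    (P : sgraph 'I_h -> Prop) : R :=
  \sum_(H : sgraph 'I_h | `[< P H >]) Gnp p H.

(* Main.v *)
Require Import Defs.
From HB Require Import structures.
From mathcomp Require Import all_boot all_order all_algebra.
From mathcomp Require Import all_classical all_reals all_analysis.
From mathcomp Require Import perm fintype finset.
From mathcomp Require Import zify ring lra.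

(** The probability space is uniform, so everything is counting, and a single
principle drives all five properties.  Fix a set [P] of pairs and, for each
[e] in [P], a reference bit [c e H] that depends only on the pairs outside [P].
Whatever the edges outside [P] are, the edges inside are still independent fair
coins, so the set of pairs of [P] at which [H] disagrees with its reference is
a uniform subset of [P] ([card_disagreements_in]).  In particular it has at most
7/15 of the elements of [P] only with probability exponentially small in [#|P|]
([Pr_few_disagreements]).

Degrees: [P] is the star at a vertex [v], with constant reference; the
disagreements with [false] are the neighbours of [v], those with [true] the
other vertices.

Agreement sets: [P] joins [x] to a set [W] avoiding [x] and [y], and the
reference of [xw] is the pair [yw]; the disagreements are the vertices of [W]
that distinguish [x] from [y].  With [W] the complement of [{x, y}] this gives
the bound for pairs of vertices, and the bound for triples follows from it by
inclusion-exclusion ([card_agreement3]).  With [W = Q] a set of about [3 log h]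
vertices, no disagreement at all occurs with probability at most [2 / h ^ 3],
so one fixed [Q] is distinguishing with high probability.

Blowups and partial isomorphisms: both compare [H] with its pullback along a
map [psi] of vertices.  If [psi] sends a set [U] outside [U], take for [P] the
pairs inside [U] that [psi] does not collapse, and the edge at [psi @: e] as the
reference of [e].  There are at most [(2 h) ^ h] pairs [(psi, U)], which is
negligible against the probability [exp (- c h ^ 2)] of few disagreements as
soon as [P] has quadratic size.  For a blowup of [H[S]] compared with [H[K]],
[psi] maps [K] to [S] and [U = K :\: S] has at least [0.1 h] elements, while the
fibres of [psi] have at most [h / 100].  For a bijection with [0.1 h]
non-stationary points, a third of these can be selected so as to be disjoint
from their images ([large_set_disjoint_from_image]), and the fibres are
singletons.  In both cases [7 #|P| / 15] exceeds [h ^ 2 / 10 ^ 5]. *)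

Set Implicit Arguments.
Unset Strict Implicit.
Unset Printing Implicit Defensive.

Import Order.TTheory GRing.Theory Num.Theory.
Import numFieldNormedType.Exports.
Local Open Scope ring_scope.

(** * Disagreements with a reference determined by the other pairs *)

Section Disagreements.
Variable T : finType.
Implicit Types (H : sgraph T) (P A D : {set {set T}}).

Definition pairs : {set {set T}} := [set e : {set T} | #|e| == 2%N].

Lemma edge_pairs H e : e \in edges H -> e \in pairs.
Proof. by move=> /card_edge eH; rewrite inE eH. Qed.

Lemma sgraph_inj H H' : edges H =i edges H' -> H = H'.
Proof. by move=> eH; apply/val_inj/setP. Qed.

Fact toggleP H A :
  [forall e in [set e in pairs | (e \in edges H) (+) (e \in A)], #|e| == 2%N].
Proof. by apply/forall_inP => e; rewrite !inE => /andP[]. Qed.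

Definition toggle H A : sgraph T :=
  exist (fun E : {set {set T}} => [forall e in E, #|e| == 2%N])
    _ (toggleP H A).

Lemma in_toggle H A e : e \in pairs ->
  (e \in edges (toggle H A)) = (e \in edges H) (+) (e \in A).
Proof. by move=> eP; rewrite /edges /= inE eP. Qed.

Definition determined_off P (c : {set T} -> sgraph T -> bool) : Prop :=
  forall e H H', e \in P -> {in ~: P, edges H =i edges H'} -> c e H = c e H'.

Definition disagreements P c H : {set {set T}} :=
  [set e in P | (e \in edges H) != c e H].

(** Toggling pairs of [P] does not move the reference, so it toggles the
disagreements; hence [H] can be recovered from its set of disagreements and
from [toggle H A] for any [A] inside [P], and the pairs [(H, A)] inject into
the pairs (set of disagreements, graph). *)
Lemma card_disagreements_in P c (B : {set {set {set T}}}) :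
    P \subset pairs -> determined_off P c ->
  (#|[set H | disagreements P c H \in B]| * 2 ^ #|P|
     <= #|[set D in B | D \subset P]| * #|{: sgraph T}|)%N.
Proof.
move=> /subsetP Ppairs cP.
rewrite -card_powerset -cardsX -cardsT -cardsX.
pose f (u : sgraph T * {set {set T}}) :=
  (disagreements P c u.1, toggle u.1 u.2).
have toggle_off H A : A \subset P -> {in ~: P, edges (toggle H A) =i edges H}.
  move=> /subsetP AP e; rewrite inE => eP; case: (boolP (e \in pairs)) => ep.
    by rewrite in_toggle // (contraNF (@AP e)) // addbF.
  have nE G : (e \in edges G) = false by apply: contraNF ep; exact: edge_pairs.
  by rewrite !nE.
rewrite -(@card_in_imset _ _ f); last first.
  move=> [H A] [H' A'] /setXP[_]; rewrite inE => AP /setXP[_].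
  rewrite inE => AP' fE.
  have eD : disagreements P c H = disagreements P c H' := congr1 fst fE.
  have eT : toggle H A = toggle H' A' := congr1 snd fE.
  have off : {in ~: P, edges H =i edges H'}.
    by move=> e eP; rewrite -(toggle_off H A) // eT toggle_off.
  have eH : H = H'.
    apply: sgraph_inj => e; case: (boolP (e \in P)) => eP; last first.
      by apply: off; rewrite inE.
    move/setP/(_ e): eD; rewrite !inE eP (cP e H H' eP off) /=.
    by case: (e \in edges H); case: (e \in edges H'); case: (c e H').
  rewrite -eH in eT *; congr pair; apply/setP => e.
  case: (boolP (e \in P)) => eP.
    have /(congr1 (fun G => e \in edges G)) := eT.
    by rewrite !in_toggle ?Ppairs // => /addbI.
  have nE (A0 : {set {set T}}) : A0 \subset P -> (e \in A0) = false.
    by move=> /subsetP A0P; apply: contraNF eP; apply: A0P.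
  by rewrite !nE.
apply/subset_leq_card/subsetP => _ /imsetP[[H A] /setXP[HB _] ->].
rewrite inE in HB; rewrite /f /= !inE HB /= andbT.
by apply/subsetP => e; rewrite inE => /andP[].
Qed.

End Disagreements.

(** * The uniform measure on graphs *)

Section Probability.
Variables (R : realType) (h : nat).
Local Notation graph := (sgraph 'I_h).
Local Notation Pr := (@Pr_Gnp R h (1 / 2)).
Implicit Types (P Q : graph -> Prop).

Lemma card_sgraph : #|{: graph}| = (2 ^ #|pairs 'I_h|)%N.
Proof.
rewrite card_sig -card_powerset; apply: eq_card => E; rewrite !inE.
by apply/forall_inP/subsetP => EP e /EP; rewrite ?inE.
Qed.

Lemma Gnp_half (H : graph) : Gnp (1 / 2 : R) H = #|{: graph}|%:R^-1.
Proof.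
rewrite card_sgraph natrX -exprVn -prodr_const /Gnp.
rewrite (eq_bigr (fun=> 2^-1)) => [|e _]; last by case: ifP => _; lra.
by apply: eq_bigl => e; rewrite inE.
Qed.

Lemma card_sgraph_gt0 : (0 < #|{: graph}|%:R :> R).
Proof. by rewrite ltr0n card_sgraph expn_gt0. Qed.

Lemma Pr_card P : Pr P = #|[set H | `[<P H>]]|%:R / #|{: graph}|%:R.
Proof.
rewrite /Pr_Gnp (eq_bigr (fun=> #|{: graph}|%:R^-1)); last first.
  by move=> H _; exact: Gnp_half.
rewrite (eq_bigl (fun H => H \in [set H | `[<P H>]])) => [|H].
  by rewrite sumr_const -[LHS]mulr_natl.
by rewrite inE.
Qed.

Lemma Pr_le P Q : (forall H, P H -> Q H) -> Pr P <= Pr Q.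
Proof.
move=> PQ; rewrite !Pr_card ler_pM2r ?invr_gt0 ?card_sgraph_gt0 // ler_nat.
apply/subset_leq_card/subsetP => H; rewrite !inE => /asboolP/PQ ?.
exact/asboolP.
Qed.

Lemma Pr_le1 P : Pr P <= 1.
Proof.
by rewrite Pr_card ler_pdivrMr ?card_sgraph_gt0 // mul1r ler_nat max_card.
Qed.

Lemma PrC P : Pr (fun H => ~ P H) = 1 - Pr P.
Proof.
rewrite !Pr_card; have -> : [set H | `[<~ P H>]] = ~: [set H | `[<P H>]].
  by apply/setP => H; rewrite !inE asbool_neg.
have := card_sgraph_gt0; rewrite -(cardsC [set H | `[<P H>]]) natrD.
by move=> ?; field; lra.
Qed.

Lemma Pr_or P Q : Pr (fun H => P H \/ Q H) <= Pr P + Pr Q.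
Proof.
rewrite !Pr_card -mulrDl ler_pM2r ?invr_gt0 ?card_sgraph_gt0 //.
rewrite -natrD ler_nat; apply: leq_trans (leq_card_setU _ _).
apply/subset_leq_card/subsetP => H; rewrite !inE => /asboolP[] ?; apply/orP;
  by [left; apply/asboolP|right; apply/asboolP].
Qed.

Lemma Pr_exists (I : finType) (F : I -> graph -> Prop) (b : R) :
  (forall i, Pr (F i) <= b) -> Pr (fun H => exists i, F i H) <= #|I|%:R * b.
Proof.
move=> Fb; apply: (@le_trans _ _ (\sum_(i : I) Pr (F i))); last first.
  by rewrite mulr_natl -sumr_const ler_sum.
under eq_bigr do rewrite Pr_card.
rewrite Pr_card -mulr_suml ler_pM2r ?invr_gt0 ?card_sgraph_gt0 //.
rewrite -natr_sum ler_nat.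
have -> : [set H | `[<exists i, F i H>]] = (\bigcup_i [set H | `[<F i H>]])%SET.
  apply/setP => H; rewrite inE; apply/asboolP/bigcupP => [[i iH]|[i _]].
    by exists i => //; rewrite inE; apply/asboolP.
  by rewrite inE => /asboolP; exists i.
by elim/big_rec2: _ => [|i m A _ le_m]; rewrite ?cards0 //
  (leq_trans (leq_card_setU _ _)) // leq_add2l.
Qed.

Lemma Pr_not_forall (I : finType) (F : I -> graph -> Prop) (b : R) :
  (forall i, Pr (fun H => ~ F i H) <= b) ->
  Pr (fun H => ~ forall i, F i H) <= #|I|%:R * b.
Proof.
move=> Fb; apply: le_trans (Pr_exists Fb); apply: Pr_le => H.
by move/existsNP.
Qed.

Lemma Pr_not_imply (C : Prop) P (b : R) : 0 <= b ->
  (C -> Pr (fun H => ~ P H) <= b) -> Pr (fun H => ~ (C -> P H)) <= b.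
Proof.
move=> b0 CPb; have [/CPb le_b|nC] := pselect C.
  by apply: le_trans le_b; apply: Pr_le => H nCP PH; apply: nCP.
rewrite Pr_card (_ : [set H | _] = set0) ?cards0 ?mul0r //.
by apply/setP => H; rewrite !inE; apply/negbTE/asboolPn; apply => /nC.
Qed.

Lemma Pr_disagreements_in (X : {set {set 'I_h}}) c
    (B : {set {set {set 'I_h}}}) :
    X \subset pairs 'I_h -> determined_off X c ->
  Pr (fun H => disagreements X c H \in B)
    <= #|[set D in B | D \subset X]|%:R / 2 ^+ #|X|.
Proof.
move=> Xp cX; rewrite Pr_card ler_pdivlMr ?exprn_gt0 ?ltr0n // mulrAC.
rewrite ler_pdivrMr ?card_sgraph_gt0 // -natrX -!natrM ler_nat.
apply: leq_trans (card_disagreements_in B Xp cX); rewrite leq_mul2r.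
apply/orP; right; apply/subset_leq_card/subsetP => H.
by rewrite !inE => /asboolP.
Qed.

End Probability.

(** * Small subsets *)

Section SmallSubsets.
Variable (R : realType).

(** The generating polynomial of the subsets of [P] counted by size. *)
Lemma sum_subset_exp (I : finType) (P : {set I}) (t : R) :
  \sum_(D : {set I} | D \subset P) t ^+ #|D| = (1 + t) ^+ #|P|.
Proof.
rewrite -prodr_const [RHS]big_mkcond.
rewrite (eq_bigr (fun i => (if i \in P then t else 0) + 1)); last first.
  by move=> i _; case: ifP => _; rewrite ?add0r // addrC.
rewrite bigA_distr big_mkcond; apply: eq_bigr => D _.
rewrite -[RHS]big_mkcond /=; case: ifPn => [/subsetP DP|/subsetPn[i iD iP]].
  by rewrite -prodr_const; apply: eq_bigr => i /DP ->.
by rewrite (bigD1 i) //= (negPf iP) mul0r.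
Qed.

(** The exponential moment method: each of the subsets counted on the left
weighs at least [s ^+ (a * #|P|)] in the generating polynomial at [s ^+ b]. *)
Lemma card_small_subsets (I : finType) (P : {set I}) (a b : nat) (s : R) :
    0 < s <= 1 ->
  #|[set D : {set I} | (b * #|D| <= a * #|P|)%N & D \subset P]|%:R / 2 ^+ #|P|
    <= ((1 + s ^+ b) / (2 * s ^+ a)) ^+ #|P|.
Proof.
move=> /andP[s0 s1]; rewrite ler_pdivrMr ?exprn_gt0 // -exprMn.
rewrite (_ : _ * 2 = (1 + s ^+ b) / s ^+ a); last first.
  by field; rewrite expf_neq0 ?gt_eqF.
rewrite exprMn exprVn ler_pdivlMr ?exprn_gt0 // -exprM -sum_subset_exp.
rewrite mulr_natl -sumr_const.
rewrite [leRHS](bigID (fun D : {set I} => b * #|D| <= a * #|P|)%N) /=.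
rewrite ler_wpDr ?sumr_ge0 // => [D _|].
  by rewrite exprn_ge0 ?exprn_ge0 ?ltW.
pose small (D : {set I}) := (b * #|D| <= a * #|P|)%N.
rewrite (eq_bigl (fun D : {set I} => (D \subset P) && small D)).
  apply: ler_sum => D /andP[_ Dle]; rewrite -exprM.
  by rewrite ler_wiXn2l // ltW.
by move=> D; rewrite inE andbC.
Qed.

(** Any ratio below 1/2 would give exponential decay.  The ratio 7/15 leaves
agreement on at most 8/15 of the vertices for a pair, which is exactly what the
bound 3/10 for triples requires.  The rate comes from [s = 99/100], for which
[(1 + s ^+ 15) / (2 * s ^+ 7)] is below 999/1000. *)
Lemma Pr_few_disagreements h (X : {set {set 'I_h}}) c :
    X \subset pairs 'I_h -> determined_off X c ->
  Pr_Gnp (1 / 2) (fun H => ~ (7 * #|X| < 15 * #|disagreements X c H|)%N)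
    <= expR (- (#|X|%:R / 1000)) :> R.
Proof.
move=> Xp cX.
pose B := [set D : {set {set 'I_h}} | (15 * #|D| <= 7 * #|X|)%N].
apply: (@le_trans _ _ (Pr_Gnp (1 / 2) (fun H => disagreements X c H \in B))).
  by apply: Pr_le => H /negP; rewrite -leqNgt inE.
apply: le_trans (Pr_disagreements_in _ B Xp cX) _.
rewrite (_ : [set D in B | D \subset X] =
  [set D : {set {set 'I_h}} | (15 * #|D| <= 7 * #|X|)%N & D \subset X]);
  last first.
  by apply/setP => D; rewrite !inE.
apply: le_trans (@card_small_subsets _ X 7 15 (99 / 100) _) _; first by lra.
apply: (@le_trans _ _ (expR (- (1 / 1000)) ^+ #|X|)); last first.
  by rewrite -expRM_natl ler_expR; lra.
apply: lerXn2r.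
- by rewrite nnegrE; apply: divr_ge0; lra.
- by rewrite nnegrE expR_ge0.
apply: (@le_trans _ _ (999 / 1000)); last first.
  by apply: le_trans (expR_ge1Dx _); lra.
by rewrite ler_pdivrMr; lra.
Qed.

End SmallSubsets.

(** * References pulled back along a vertex map *)

Lemma imset_pair (T T' : finType) (f : T -> T') x y :
  f @: [set x; y] = [set f x; f y].
Proof. by rewrite imsetU1 imset_set1. Qed.

Section Pullback.
Variable T : finType.
Implicit Types (H : sgraph T) (P : {set {set T}}) (W U : {set T}).

Definition pullback (psi : T -> T) (e : {set T}) H : bool :=
  psi @: e \in edges H.

Lemma pullback_determined P psi :
  (forall e, e \in P -> psi @: e \notin P) -> determined_off P (pullback psi).
Proof. by move=> Poff e H H' eP; apply; rewrite inE Poff. Qed.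

Definition spokes (x : T) W : {set {set T}} := [set [set x; w] | w in W].

Lemma spokes_inj x : injective (fun w : T => [set x; w]).
Proof.
move=> w w' /setP ww'; move: (ww' w) (ww' w'); rewrite !inE !eqxx !orbT.
case: (eqVneq w x) => [->|_ /esym/eqP//].
by case: (eqVneq w' x) => //= _ _ /eqP.
Qed.

Lemma card_spokes x W : #|spokes x W| = #|W|.
Proof. by rewrite card_imset //; exact: spokes_inj. Qed.

Lemma spokes_pairs x W : x \notin W -> spokes x W \subset pairs T.
Proof.
move=> xW; apply/subsetP => _ /imsetP[w wW ->]; rewrite inE cards2.
by rewrite (_ : x != w) //; apply: contraNneq xW => ->.
Qed.

Lemma card_disagreements_spokes x W c H :
  #|disagreements (spokes x W) c H| =
  #|[set w in W | adj H x w != c [set x; w] H]|.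
Proof.
rewrite -(card_imset _ (@spokes_inj x)); apply: eq_card => e.
rewrite inE; apply/andP/imsetP => [[/imsetP[w wW ->] Hc]|[w]].
  by exists w => //; rewrite inE wW.
by rewrite inE => /andP[wW Hc] ->; split => //; apply: imset_f.
Qed.

Lemma spokes_tperm_determined x y W : x != y -> x \notin W -> y \notin W ->
  determined_off (spokes x W) (pullback (tperm x y)).
Proof.
move=> xy xW yW; apply: pullback_determined => _ /imsetP[w wW ->].
rewrite imset_pair tpermL; apply/imsetP => -[w' w'W /setP/(_ y)].
rewrite !inE eqxx [y == x]eq_sym (negPf xy) /= => /esym/eqP yw'.
by rewrite yw' w'W in yW.
Qed.

Lemma pullback_tperm x y w H : w != x -> w != y ->
  pullback (tperm x y) [set x; w] H = adj H y w.
Proof.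
by move=> wx wy; rewrite /pullback imset_pair tpermL tpermD // eq_sym.
Qed.

Definition split_pairs (psi : T -> T) U : {set {set T}} :=
  [set e in pairs T | (e \subset U) && (#|psi @: e| == 2%N)].

Lemma split_pairs_pairs psi U : split_pairs psi U \subset pairs T.
Proof. by apply/subsetP => e; rewrite inE => /andP[]. Qed.

(** Flags (vertex, split pair through it) are counted twice: each pair carries
two, each vertex of [U] lies on as many as there are vertices of [U] outside
its fibre. *)
Lemma card_split_pairs psi U (f : nat) :
    {in U, forall x, #|[set y in U | psi y == psi x]| <= f}%N ->
  (#|U| * (#|U| - f) <= 2 * #|split_pairs psi U|)%N.
Proof.
move=> fib.
have <- : (\sum_(e in split_pairs psi U) \sum_(x in e) 1
    = 2 * #|split_pairs psi U|)%N.
  rewrite mulnC -sum_nat_const; apply: eq_bigr => e.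
  by rewrite sum1_card !inE => /andP[/eqP].
rewrite (exchange_big_dep predT) //= -sum_nat_const big_mkcond /=.
apply: leq_sum => x _; case: ifP => // xU.
rewrite sum1_card.
pose W := [set y in U | psi y != psi x].
apply: (@leq_trans #|W|).
  rewrite leq_subLR -(cardsID [set y | psi y == psi x] U) leq_add //.
    apply: leq_trans (fib x xU).
    by apply/subset_leq_card/subsetP => y; rewrite !inE.
  by apply/subset_leq_card/subsetP => y; rewrite !inE andbC.
rewrite -(card_spokes x W).
apply/subset_leq_card/subsetP => _ /imsetP[y + ->]; rewrite inE => /andP[yU yx].
rewrite unfold_in !inE imset_pair !cards2 eqxx /= andbT [psi x == _]eq_sym yx.
case: (eqVneq x y) => [xy|_] /=; first by rewrite xy eqxx in yx.
by rewrite andbT; apply/subsetP => z; rewrite !inE => /orP[]/eqP->.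
Qed.

Lemma split_pairs_determined psi U : [disjoint psi @: U & U] ->
  determined_off (split_pairs psi U) (pullback psi).
Proof.
move=> dU; apply: pullback_determined => e.
rewrite !inE => /and3P[_ eU /eqP e2].
apply/negP => /and3P[_ peU _].
have : (0 < #|psi @: e|)%N by rewrite e2.
move=> /card_gt0P[z ze]; move/disjointFr: dU => /(_ z).
by rewrite (subsetP peU) // (subsetP (imsetS psi eU)) // => /(_ isT).
Qed.

(** Both comparisons of the definition, with a blowup and along a bijection,
are instances: [phi] places the compared graphs inside [H], one of them as the
subgraph on its image, the other one through [psi]. *)
Lemma card_disagreements_changed (W : finType) (B B' : sgraph W)
    (phi : W -> T) psi P H :
    injective phi ->
    (forall u v, adj B u v = adj H (phi u) (phi v)) ->
    (forall u v, adj B' u v = adj H (psi (phi u)) (psi (phi v))) ->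
    P \subset pairs T -> (forall e, e \in P -> e \subset phi @: [set: W]) ->
  (#|disagreements P (pullback psi) H|
     <= #|[set e in changed B B' | phi @: e \in P]|)%N.
Proof.
move=> phi_inj BE B'E /subsetP Pp Pphi.
rewrite -(card_imset _ (imset_inj phi_inj)); apply/subset_leq_card/subsetP => e.
rewrite inE => /andP[eP De].
have /cards2P[x [y [xy exy]]] : #|e| == 2%N by move/Pp: eP; rewrite inE.
have /subsetP ephi := Pphi e eP.
have /imsetP[u _ xu] : x \in phi @: [set: W] by rewrite ephi // exy !inE eqxx.
have /imsetP[v _ yv] : y \in phi @: [set: W].
  by rewrite ephi // exy !inE eqxx orbT.
have euv : e = phi @: [set u; v] by rewrite imset_pair exy xu yv.
apply/imsetP; exists [set u; v] => //; rewrite !inE -euv eP andbT.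
move: De; rewrite /pullback euv imset_pair imset_pair.
by rewrite -![[set _; _] \in edges _]/(adj _ _ _) BE B'E.
Qed.

End Pullback.

(** * Four typical properties *)

Section Typical.
Variable h : nat.
Local Notation V := 'I_h.
Implicit Types (H : sgraph V) (Q U S : {set V}).

(** Disagreeing with [false] means being an edge, disagreeing with [true] being
a non-edge: the two cases bound the degree from below and from above. *)
Definition even_stars H : Prop := forall (v : V) (b : bool),
  (7 * h.-1 < 15 * #|disagreements (spokes v [set~ v]) (fun _ _ => b) H|)%N.

Definition even_agreements H : Prop := forall x y : V, x != y ->
  (7 * (h - 2) < 15 *
     #|disagreements (spokes x (~: [set x; y])) (pullback (tperm x y)) H|)%N.

Definition separates Q H : Prop := forall x y : V,
  [/\ x \notin Q, y \notin Q & x != y] ->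
  disagreements (spokes x Q) (pullback (tperm x y)) H \notin [set set0].

(** The threshold [h ^ 2 / 2000] is low enough for the sets [U] built from
blowups and from bijections; being quadratic, it beats the [(2 h) ^ h] choices
of [psi] and [U] in the union bound. *)
Definition no_approximate_self_map H : Prop :=
  forall (psi : {ffun V -> V}) U,
    [disjoint psi @: U & U] /\ (h ^ 2 <= 2000 * #|split_pairs psi U|)%N ->
  (7 * #|split_pairs psi U| <
     15 * #|disagreements (split_pairs psi U) (pullback psi) H|)%N.

Lemma card_setC2 (x y : V) : x != y -> #|~: [set x; y]| = (h - 2)%N.
Proof. by move=> xy; rewrite cardsCs setCK cards2 xy card_ord. Qed.

Section Probabilities.
Variable R : realType.
Local Notation Pr := (@Pr_Gnp R h (1 / 2)).

Lemma Pr_not_even_stars :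
  Pr (fun H => ~ even_stars H) <= h%:R * (2 * expR (- (h.-1%:R / 1000))).
Proof.
rewrite -[in h%:R](card_ord h) /even_stars; refine (Pr_not_forall _) => v.
have -> : 2 * expR (- (h.-1%:R / 1000))
    = #|{: bool}|%:R * expR (- (h.-1%:R / 1000)) :> R.
  by rewrite card_bool.
refine (Pr_not_forall _) => b.
have vW : v \notin [set~ v] by rewrite !inE eqxx.
have <- : #|spokes v [set~ v]| = h.-1.
  by rewrite card_spokes cardsC1 card_ord.
by apply: Pr_few_disagreements => //; exact: spokes_pairs.
Qed.

Lemma Pr_not_even_agreements :
  Pr (fun H => ~ even_agreements H)
    <= h%:R * (h%:R * expR (- ((h - 2)%:R / 1000))).
Proof.
rewrite -[in h%:R](card_ord h) /even_agreements; refine (Pr_not_forall _) => x.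
apply: Pr_not_forall => y; apply: Pr_not_imply => [|xy]; first exact: expR_ge0.
have xW : x \notin ~: [set x; y] by rewrite !inE eqxx.
have yW : y \notin ~: [set x; y] by rewrite !inE eqxx orbT.
rewrite -(card_setC2 xy) -(card_spokes x).
apply: Pr_few_disagreements; first exact: spokes_pairs.
exact: spokes_tperm_determined.
Qed.

Lemma Pr_not_separates Q :
  Pr (fun H => ~ separates Q H) <= h%:R * (h%:R / 2 ^+ #|Q|).
Proof.
rewrite -[in h%:R](card_ord h) /separates; refine (Pr_not_forall _) => x.
refine (Pr_not_forall _) => y.
apply: Pr_not_imply => [|[xQ yQ xy]]; first by rewrite invr_ge0 exprn_ge0.
rewrite -(card_spokes x Q).
apply: (@le_trans _ _ (Pr (fun H =>
  disagreements (spokes x Q) (pullback (tperm x y)) H \in [set set0]))).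
  by apply: Pr_le => H /negP; rewrite negbK.
apply: le_trans (Pr_disagreements_in _ _ (spokes_pairs xQ)
  (spokes_tperm_determined xy xQ yQ)) _.
rewrite -[leRHS]mul1r ler_pM2r ?invr_gt0 ?exprn_gt0 //.
rewrite lern1 -(cards1 (@set0 {set V})).
by apply/subset_leq_card/subsetP => D; rewrite !inE => /andP[].
Qed.

Lemma Pr_not_no_approximate_self_map :
  Pr (fun H => ~ no_approximate_self_map H)
    <= (h ^ h)%:R * (2 ^+ h * expR (- (h%:R ^+ 2 / 2000 / 1000))).
Proof.
rewrite /no_approximate_self_map.
have <- : #|{: {ffun V -> V}}| = (h ^ h)%N by rewrite card_ffun card_ord.
refine (Pr_not_forall _) => psi.
have <- : #|{: {set V}}|%:R = 2 ^+ h :> R.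
  by rewrite -cardsT -powersetT card_powerset cardsT card_ord natrX.
refine (Pr_not_forall _) => U.
apply: Pr_not_imply => [|[dU le_h]]; first exact: expR_ge0.
apply: le_trans (Pr_few_disagreements _ (split_pairs_pairs _ _)
  (split_pairs_determined dU)) _.
rewrite -(ler_nat R) natrX natrM in le_h; rewrite ler_expR lerN2.
by move: le_h; set x := _ ^+ 2; set y := #|_|%:R; lra.
Qed.

End Probabilities.

End Typical.

(** * Typical graphs are strongly asymmetric *)

Section Consequences.
Variables (R : realType) (h : nat).
Local Notation V := 'I_h.
Implicit Types (H : sgraph V) (Q U S : {set V}).

(** From 8 vertices on, 7/15 of the [h - 1] other vertices exceed [0.4 h]. *)
Lemma even_stars_degrees H : (8 <= h)%N -> even_stars H -> balanced_degrees R H.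
Proof.
move=> h8 even n v; rewrite {}/n.
have := even v true; have := even v false; rewrite !card_disagreements_spokes.
have -> : [set w in [set~ v] | adj H v w != false] = [set w | adj H v w].
  apply/setP => w; rewrite !inE; case: (eqVneq w v) => [->|_] /=.
    by rewrite adj_irr.
  by case: (adj H v w).
have -> : #|[set w in [set~ v] | adj H v w != true]| = (h.-1 - degree H v)%N.
  rewrite -[in h.-1](card_ord h) -(cardsC1 v) -cardsDS; last first.
    apply/subsetP => w; rewrite !inE.
    by apply: contraTneq => ->; rewrite adj_irr.
  by apply: eq_card => w; rewrite !inE eqb_id andbC.
rewrite -/(degree H v) => lo hi.
have lo' : (4 * h < 10 * degree H v)%N by lia.
have hi' : (10 * degree H v < 6 * h)%N by lia.
rewrite -(ltr_nat R) !natrM in lo'; rewrite -(ltr_nat R) !natrM in hi'.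
by apply/andP; split; lra.
Qed.

Lemma in_agreement2 H x y w :
  (w \in agreement H [set x; y])
    = [&& w != x, w != y & adj H w x == adj H w y].
Proof.
rewrite inE !inE negb_or -andbA; do 2!congr (_ && _).
apply/orP/eqP => [[]/forall_inP a|e].
- by rewrite !a // !inE eqxx ?orbT.
- by rewrite (negbTE (a x _)) ?(negbTE (a y _)) // !inE eqxx ?orbT.
case: (boolP (adj H w x)) => wx; [left|right]; apply/forall_inP => v;
  by rewrite !inE => /orP[]/eqP->; rewrite -?e.
Qed.

Lemma in_agreement3 H x y z w :
  (w \in agreement H [set x; y; z]) =
    [&& w \in agreement H [set x; y], w \in agreement H [set x; z]
      & w \in agreement H [set y; z]].
Proof.
rewrite !in_agreement2 inE !inE !negb_or.
apply/andP/and3P => [[/andP[/andP[-> ->] ->] a]|].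
  have [axy axz ayz] : [/\ adj H w x = adj H w y, adj H w x = adj H w z
      & adj H w y = adj H w z].
    by case/orP: a => /forall_inP a; [|split; apply/negb_inj];
      rewrite ?a // !inE eqxx ?orbT.
  by rewrite axy ayz !eqxx.
move=> [/and3P[-> -> e] /and3P[_ -> e'] _].
split=> //; apply/orP; case: (boolP (adj H w x)) => wx; [left|right];
  by apply/forall_inP => v; rewrite !inE => /orP[/orP[]|] /eqP->;
    rewrite -?(eqP e) -?(eqP e').
Qed.

Lemma card_agreement2 H x y : x != y -> even_agreements H ->
  (15 * #|agreement H [set x; y]| <= 8 * (h - 2))%N.
Proof.
move=> xy /(_ x y xy); rewrite card_disagreements_spokes -(card_setC2 xy).
set D := [set w in _ | _]; set W := ~: _ => lo.
have -> : #|agreement H [set x; y]| = (#|W| - #|D|)%N; last by lia.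
have DW : D \subset W by apply/subsetP => w; rewrite inE => /andP[].
rewrite -cardsDS //; apply: eq_card => w.
rewrite in_agreement2 !inE !negb_or.
case: (eqVneq w x) => [|wx]; rewrite ?andbF //=.
case: (eqVneq w y) => [|wy]; rewrite ?andbF //= andbT.
by rewrite pullback_tperm // negbK !(adj_sym H w).
Qed.

(** Outside a triple, a vertex lies in all three agreement sets of its pairs or
in exactly one, so that bounds near one half for pairs give a bound near one
quarter for the triple. *)
Lemma card_agreement3 H x y z : x != y -> x != z -> y != z ->
    even_agreements H ->
  (10 * #|agreement H [set x; y; z]| <= 3 * h)%N.
Proof.
move=> xy xz yz even.
have xyz : #|~: [set x; y; z]| = (h - 3)%N.
  rewrite cardsCs setCK card_ord -setUA cardsU1 cards2 yz !inE.
  by rewrite (negPf xy) (negPf xz).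
have h3 : (3 <= h)%N.
  rewrite -[h]card_ord -cardsT.
  apply: leq_trans (subset_leq_card (subsetT [set x; y; z])).
  by rewrite -setUA cardsU1 cards2 yz !inE (negPf xy) (negPf xz).
have := card_agreement2 xy even; have := card_agreement2 xz even.
have := card_agreement2 yz even.
suff : (#|~: [set x; y; z]| + 2 * #|agreement H [set x; y; z]|
    <= #|agreement H [set x; y]| + #|agreement H [set x; z]|
       + #|agreement H [set y; z]|)%N by rewrite xyz; lia.
have card_sum (A : {set V}) : #|A| = (\sum_w (w \in A))%N.
  by rewrite -sum1_card big_mkcond; apply: eq_bigr => w _; case: ifP.
rewrite !card_sum big_distrr -!big_split /=.
apply: leq_sum => w _; rewrite in_agreement3 !in_agreement2 !inE !negb_or.
case: (eqVneq w x) => [|wx]; first by rewrite muln0.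
case: (eqVneq w y) => [|wy]; first by rewrite ?andbF muln0.
case: (eqVneq w z) => [|wz]; first by rewrite ?andbF muln0.
by case: (adj H w x); case: (adj H w y); case: (adj H w z).
Qed.

Lemma even_agreements_small H : even_agreements H -> small_agreement R H.
Proof.
move=> even n; rewrite {}/n; split=> S.
  move=> /eqP/cards2P[x [y [xy ->]]]; have := card_agreement2 xy even => le.
  have {}le : (100 * #|agreement H [set x; y]| <= 55 * h)%N by lia.
  by rewrite -(ler_nat R) !natrM in le; lra.
move=> S3.
have /card_gt0P[x xS] : (0 < #|S|)%N by rewrite S3.
have /cards2P[y [z [yz Sx]]] : #|S :\ x| == 2%N.
  by rewrite -eqSS -[_.+1]/(1 + _)%N; move: S3; rewrite (cardsD1 x) xS => ->.
have yS : y \in S :\ x by rewrite Sx !inE eqxx.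
have zS : z \in S :\ x by rewrite Sx !inE eqxx orbT.
have SE : S = [set x; y; z] by rewrite -(setD1K xS) Sx setUA.
move: yS zS; rewrite !inE => /andP[yx _] /andP[zx _].
have xy : x != y by rewrite eq_sym.
have xz : x != z by rewrite eq_sym.
have := card_agreement3 xy xz yz even; rewrite -SE => le.
by rewrite -(ler_nat R) !natrM in le; lra.
Qed.

Lemma separates_distinguishing Q H : separates Q H -> distinguishing H Q.
Proof.
move=> sep x y xQ yQ xy; apply/negP => /subsetP Qagr.
have := sep x y (And3 xQ yQ xy); rewrite inE => /negP; apply.
rewrite -cards_eq0 card_disagreements_spokes cards_eq0; apply/eqP/setP => w.
rewrite !inE; apply/negbTE; rewrite negb_and -implybE negbK; apply/implyP => wQ.
move: (Qagr w wQ); rewrite in_agreement2 => /and3P[wx wy].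
by rewrite pullback_tperm // !(adj_sym H w).
Qed.

End Consequences.

(** Take a maximal subset [U] of [N] disjoint from its image: each other point of
[N] is the image of a point of [U] or is mapped into [U], since adding it to [U]
must fail. *)
Lemma large_set_disjoint_from_image (T : finType) (psi : T -> T) (N : {set T}) :
    {in N &, injective psi} -> {in N, forall x, psi x != x} ->
  exists U : {set T}, [/\ U \subset N, [disjoint psi @: U & U]
    & (#|N| <= 3 * #|U|)%N].
Proof.
move=> psi_inj psi_ne.
pose good (U : {set T}) := (U \subset N) && [disjoint psi @: U & U].
have good0 : good set0.
  by rewrite /good sub0set imset0; apply/pred0P => x; rewrite !inE.
have [U /maxsetP[/andP[UN dU] maxU] _] := maxset_exists good0.
exists U; split=> //; pose W := [set x in N | psi x \in U].
have WU : (#|W| <= #|U|)%N.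
  rewrite -(@card_in_imset _ _ psi) => [|x y]; last first.
    by rewrite !inE => /andP[xN _] /andP[yN _]; apply: psi_inj.
  by apply/subset_leq_card/subsetP => _ /imsetP[x + ->]; rewrite inE => /andP[].
have -> : (3 * #|U| = #|U| + #|U| + #|U|)%N by lia.
suff : N \subset U :|: psi @: U :|: W.
  move=> /subset_leq_card /leq_trans; apply.
  apply: leq_trans (leq_card_setU _ _) _; apply: leq_add WU.
  by apply: leq_trans (leq_card_setU _ _) _; rewrite leq_add2l leq_imset_card.
apply/subsetP => x xN; rewrite !inE xN /=; apply/negPn/negP.
rewrite !negb_or => /andP[/andP[xU xpU] pxU].
suff /maxU : good (x |: U).
  move=> /(_ (subsetUr _ _)) /setP/(_ x); rewrite !inE eqxx (negPf xU).
  by [].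
rewrite /good subUset sub1set xN UN /=; apply/pred0P => z /=.
apply/negP => /andP[/imsetP[y + ->]]; rewrite !inE => /orP[/eqP->|yU].
  by rewrite (negPf (psi_ne _ xN)) (negPf pxU).
move=> /orP[/eqP pyx|pyU]; first by rewrite -pyx imset_f in xpU.
by rewrite (disjointFr dU (imset_f psi yU)) in pyU.
Qed.

Section FarFrom.
Variables (R : realType) (h : nat).
Local Notation V := 'I_h.
Implicit Types (H : sgraph V) (Q U S : {set V}).

Lemma no_approximate_self_map_far H (psi : {ffun V -> V}) U (m : nat) :
    no_approximate_self_map H -> [disjoint psi @: U & U] ->
    (h ^ 2 <= 2000 * #|split_pairs psi U|)%N ->
    (#|disagreements (split_pairs psi U) (pullback psi) H| <= m)%N ->
  ~ m%:R <= 10 ^- 5 * h%:R ^+ 2 :> R.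
Proof.
move=> rigid dU le_h le_m few; have := rigid psi U (conj dU le_h).
rewrite -!(ler_nat R) natrX natrM in le_h le_m.
rewrite -(ltr_nat R) !natrM => many; move: few le_h le_m many.
set x := h%:R ^+ 2; set p := #|split_pairs _ _|%:R; set d := #|_|%:R.
have : 0 <= x by rewrite exprn_ge0.
by rewrite -exprVn; lra.
Qed.

(** The reference map sends a vertex of the comparison set to the vertex of
[H] that its part comes from; it is studied on the vertices outside [S], where
it takes its values in [S]. *)
Lemma far_from_blowups_typical H :
  no_approximate_self_map H -> far_from_blowups R H.
Proof.
move=> rigid n; rewrite {}/n => S a K S_le _ /andP[K_ge _] a_le cardK.
move=> [B [few [f [[g fK gK] fE]]]].
pose psi : {ffun V -> V} :=
  [ffun x => if (insub x : option {x | x \in K}) is Some k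
             then val (tag (g k)) else x].
pose phi (u : blowup_vertex a) : V := val (f u).
have phi_inj : injective phi by move=> u v /val_inj /(can_inj fK).
have psi_phi u : psi (phi u) = val (tag u) by rewrite ffunE valK fK.
have phi_onto x : x \in K -> exists u, x = phi u.
  by move=> xK; exists (g (exist _ x xK)); rewrite /phi gK.
pose U := K :\: S.
have UK x : x \in U -> exists u, x = phi u.
  by rewrite inE => /andP[_ /phi_onto].
have dU : [disjoint psi @: U & U].
  apply/pred0P => x /=; apply/negP => /andP[/imsetP[y /UK[u ->] ->]].
  by rewrite psi_phi inE (valP (tag u)).
have fib : {in U, forall x, #|[set y in U | psi y == psi x]| <= h %/ 100}%N.
  move=> x /UK[u ->]; apply: (@leq_trans (a (tag u))); last first.
    rewrite leq_divRL // -(ler_nat R) natrM; have := a_le (tag u).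
    by rewrite ler_pdivlMr.
  rewrite -[leqRHS](card_ord (a (tag u))).
  pose part (j : 'I_(a (tag u))) := phi (Tagged (fun i => 'I_(a i)) j).
  apply: leq_trans (leq_imset_card part 'I_(a (tag u))).
  apply/subset_leq_card/subsetP => y; rewrite inE => /andP[/UK[v ->]].
  rewrite !psi_phi => /eqP/val_inj; rewrite {}/part.
  by move: (tag u) => i; case: v => i' j' /= <-; apply: (imset_f (fun j => _)).
have U_ge : (h <= 10 * #|U|)%N.
  have : (#|K| <= #|U| + #|S|)%N.
    by rewrite -(cardsID S K) addnC leq_add2l subset_leq_card // subsetIr.
  by rewrite -(ler_nat R) natrD -(ler_nat R) natrM cardK; lra.
have := card_split_pairs fib => P_ge.
have le_h : (h ^ 2 <= 2000 * #|split_pairs psi U|)%N.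
  have : (100 * (h %/ 100) <= h)%N by rewrite mulnC leq_divM.
  move: P_ge U_ge; set f' := (h %/ 100)%N; set u := #|U|.
  set p := #|_| => P_ge U_ge f_le.
  have u_f : (9 * u <= 10 * (u - f'))%N by lia.
  have : (u * (9 * u) <= u * (10 * (u - f')))%N by rewrite leq_mul2l u_f orbT.
  have : (h * h <= (10 * u) * (10 * u))%N by apply: leq_mul.
  rewrite -mulnn; nia.
apply: (no_approximate_self_map_far rigid dU le_h) few.
have Pp := split_pairs_pairs psi U.
apply: leq_trans (card_disagreements_changed (B := B)
  (B' := blowup (induced_graph H S) a) phi_inj _ _ Pp _) _.
- by move=> u v; rewrite -fE adj_induced_graph.
- by move=> u v; rewrite !psi_phi adj_blowup adj_induced_graph.
- move=> e; rewrite inE => /and3P[_ /subsetP eU _]; apply/subsetP => x.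
  by move=> /eU/UK[u ->]; apply: imset_f.
apply/subset_leq_card/subsetP => e; rewrite !inE eq_sym => /andP[-> /=].
rewrite card_imset // => /and3P[/cards2P[u [v [_ ->]]] _ uv2].
rewrite /blowup_pair /part_pair cards2.
have uv : tag u != tag v.
  move: uv2; rewrite !imset_pair !psi_phi cards2 eqSS eqb1.
  by apply: contra_neq => ->.
rewrite (_ : u != v) /=; last by apply: contraNneq uv => ->.
apply/negP => /forall_inP/(_ u); rewrite !inE eqxx => /(_ isT)/forall_inP/(_ v).
by rewrite !inE eqxx orbT (negPf uv) => /(_ isT).
Qed.

Lemma far_from_isomorphisms_typical H : (300 <= h)%N ->
  no_approximate_self_map H -> far_from_isomorphisms R H.
Proof.
move=> h300 rigid n; rewrite {}/n => J K f _ _ f_bij N_ge.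
move=> [H' [few [_ fE]]].
pose psi : {ffun V -> V} :=
  [ffun x => if (insub x : option {x | x \in J}) is Some k
             then val (f k) else x].
have psi_val u : psi (val u) = val (f u) by rewrite ffunE valK.
have val_onto x : x \in val @: nonstationary f ->
  exists2 u, u \in nonstationary f & x = val u by move=> /imsetP.
have [||U [UN dU U_ge]] :=
    @large_set_disjoint_from_image _ psi (val @: nonstationary f).
- move=> _ _ /val_onto[u _ ->] /val_onto[v _ ->]; rewrite !psi_val.
  by move=> /val_inj /(bij_inj f_bij) ->.
- by move=> _ /val_onto[u + ->]; rewrite psi_val inE.
rewrite (card_imset _ val_inj) in U_ge.
have UJ x : x \in U -> exists u : {x : V | x \in J}, x = val u.
  by move=> /(subsetP UN)/val_onto[u _ ->]; exists u.
have N_ge' : (h <= 10 * #|nonstationary f|)%N.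
  by rewrite -(ler_nat R) natrM; lra.
have fib : {in U, forall x, #|[set y in U | psi y == psi x]| <= 1}%N.
  move=> x /UJ[u ->]; rewrite -(cards1 (val u)).
  apply/subset_leq_card/subsetP => y; rewrite !inE => /andP[/UJ[v ->]].
  by rewrite !psi_val => /eqP/val_inj/(bij_inj f_bij) ->.
have := card_split_pairs fib => P_ge.
have le_h : (h ^ 2 <= 2000 * #|split_pairs psi U|)%N.
  (* [h >= 300] makes [#|U| >= 10], so that [#|U| - 1] is at least [0.9 #|U|]. *)
  have u_ge : (h <= 30 * #|U|)%N.
    apply: leq_trans N_ge' _; rewrite -[30%N]/(10 * 3)%N -mulnA leq_mul2l.
    exact: U_ge.
  have : (h * h <= (30 * #|U|) * (30 * #|U|))%N by apply: leq_mul.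
  have : (#|U| * (9 * #|U|) <= #|U| * (10 * (#|U| - 1)))%N.
    by rewrite leq_mul2l; apply/orP; right; lia.
  by rewrite -mulnn; nia.
apply: (no_approximate_self_map_far rigid dU le_h) few.
have Pp := split_pairs_pairs psi U.
apply: leq_trans (card_disagreements_changed (B := induced_graph H J)
  (B' := H') val_inj _ _ Pp _) _.
- by move=> u v; rewrite adj_induced_graph.
- by move=> u v; rewrite !psi_val -fE adj_induced_graph.
- move=> e; rewrite inE => /and3P[_ /subsetP eU _]; apply/subsetP => x.
  by move=> /eU/UJ[u ->]; apply: imset_f.
by apply/subset_leq_card/subsetP => e; rewrite inE => /andP[].
Qed.

End FarFrom.

(** * Failure probabilities *)

Section Rates.
Variable R : realType.

(** The cube leaves a factor [1 / h] after a union bound over pairs. *)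
Lemma expRN_le_cube (gamma : R) : 0 < gamma ->
  exists2 C : R, 0 <= C &
    forall h, (0 < h)%N -> expR (- (gamma * h%:R)) <= C / h%:R ^+ 3.
Proof.
move=> g0; exists ((3 / gamma) ^+ 3) => [|h h0].
  by rewrite exprn_ge0 // divr_ge0 // ltW.
have h0' : 0 < h%:R :> R by rewrite ltr0n.
set z := gamma * h%:R / 3.
have z0 : 0 < z by rewrite divr_gt0 ?mulr_gt0.
have -> : - (gamma * h%:R) = 3%:R * - z by rewrite /z; field.
rewrite expRM_natl -expr_div_n (_ : 3 / gamma / h%:R = z^-1); last first.
  by rewrite /z; field; rewrite !gt_eqF.
apply: lerXn2r; rewrite ?nnegrE ?expR_ge0 ?invr_ge0 ?(ltW z0) //.
rewrite expRN lef_pV2 ?posrE ?expR_gt0 //.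
by apply: le_trans (expR_ge1Dx z); rewrite lerDr.
Qed.

Local Notation Pr h := (@Pr_Gnp R h (1 / 2)).

Lemma le_mul2_div_cube (C : R) (h : nat) (x : R) : (0 < h)%N -> 0 <= C ->
  x <= C / h%:R ^+ 3 -> h%:R * (h%:R * x) <= C / h%:R.
Proof.
move=> h0 C0 le_x; have h0' : 0 < h%:R :> R by rewrite ltr0n.
rewrite (_ : C / h%:R = h%:R * (h%:R * (C / h%:R ^+ 3))); last first.
  by field; rewrite gt_eqF.
by rewrite !ler_pM2l.
Qed.

Lemma even_rate : exists2 C : R, 0 <= C & forall h, (0 < h)%N ->
  Pr h (fun H => ~ even_stars H) <= C / h%:R /\
  Pr h (fun H => ~ even_agreements H) <= C / h%:R.
Proof.
have [|C C0 le_C] := @expRN_le_cube (1 / 1000); first by lra.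
(* [e] pays for replacing [h - d] by [h] in the exponent. *)
set e := expR (2 / 1000) : R; have e0 : 0 <= e by exact: expR_ge0.
have exp_le h d : (0 < h)%N -> (d <= 2)%N ->
    expR (- ((h - d)%:R / 1000)) <= (e * C) / h%:R ^+ 3.
  move=> h0 d2; rewrite -mulrA; apply: le_trans (ler_wpM2l e0 (le_C h h0)).
  rewrite -expRD ler_expR.
  have : (h <= (h - d) + 2)%N by lia.
  by rewrite -(ler_nat R) natrD; lra.
have eC : 0 <= e * C by rewrite mulr_ge0.
exists (2 * (e * C)) => [|h h0]; first by rewrite mulr_ge0.
have h1 : 1 <= h%:R :> R by rewrite ler1n.
have h0' : 0 < h%:R :> R by rewrite ltr0n.
split.
  apply: le_trans (Pr_not_even_stars _ _) _; rewrite -subn1.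
  have := le_mul2_div_cube h0 eC (exp_le h 1%N h0 isT).
  set x := expR _ => le_x; rewrite mulrCA -mulrA ler_pM2l //.
  by apply: le_trans le_x; rewrite ler_pM2l // ler_peMl // expR_ge0.
apply: le_trans (Pr_not_even_agreements _ _) _.
apply: le_trans (le_mul2_div_cube h0 eC (exp_le h 2%N h0 isT)) _.
rewrite ler_pM2r ?invr_gt0 //; lra.
Qed.

Lemma cube_le_exp2 h : (10 <= h)%N -> (h ^ 3 <= 2 ^ h)%N.
Proof.
elim: h => // h IH; rewrite leq_eqVlt => /orP[/eqP<- //|h10].
rewrite [leqRHS]expnS; apply: leq_trans (leq_mul (leqnn 2) (IH h10)).
rewrite !expnS !expn0 !muln1; nia.
Qed.

(** With [3 log h] vertices, rounded down, a given pair is left unseparated with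
probability less than [2 / h ^ 3]. *)
Lemma separates_rate h : (10 <= h)%N -> exists2 Q : {set 'I_h},
  #|Q|%:R <= 3 * log2 (h%:R : R) & Pr h (fun H => ~ separates Q H) <= 2 / h%:R.
Proof.
move=> h10; have h0 : (0 < h)%N by lia.
have h0' : 0 < h%:R :> R by rewrite ltr0n.
pose q := trunc_log 2 (h ^ 3).
have q_le : (2 ^ q <= h ^ 3)%N by rewrite trunc_logP // expn_gt0 h0.
have q_gt : (h ^ 3 < 2 ^ q.+1)%N by rewrite trunc_log_ltn.
have qh : (q <= h)%N.
  by rewrite -(@leq_exp2l 2) // (leq_trans q_le) // cube_le_exp2.
pose Q := [set widen_ord qh i | i : 'I_q].
have cardQ : #|Q| = q.
  by rewrite card_imset ?card_ord // => i j /(congr1 val) /= /val_inj.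
exists Q; rewrite ?cardQ.
  have ln2 : 0 < ln 2 :> R by rewrite ln_gt0 // ltr1n.
  rewrite /log2 mulrA ler_pdivlMr // mulr_natl -lnXn // mulr_natl -lnXn //.
  by rewrite ler_ln ?posrE ?exprn_gt0 // -!natrX ler_nat.
apply: le_trans (Pr_not_separates R Q) _.
rewrite cardQ; apply: le_mul2_div_cube => //.
rewrite ler_pdivlMr ?exprn_gt0 // mulrC ler_pdivrMr ?exprn_gt0 //.
by rewrite -exprS -!natrX ler_nat ltnW.
Qed.

(** The bound is the [h]-th power of [2 * h * expR (- c * h)], which is itself
below [1 / h] once [h] is large. *)
Lemma no_approximate_self_map_rate : exists C : R, forall h, (0 < h)%N ->
  C <= h%:R -> Pr h (fun H => ~ no_approximate_self_map H) <= 1 / h%:R.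
Proof.
have [|C C0 le_C] := @expRN_le_cube (1 / 2000 / 1000); first by lra.
exists (2 * C) => h h0 Ch; have h0' : 0 < h%:R :> R by rewrite ltr0n.
apply: le_trans (Pr_not_no_approximate_self_map _ _) _.
have -> : expR (- (h%:R ^+ 2 / 2000 / 1000)) =
    expR (- (1 / 2000 / 1000 * h%:R)) ^+ h :> R.
  by rewrite -expRM_natl; congr expR; field.
rewrite natrX mulrA -!exprMn; set x := _ * _.
have x0 : 0 <= x by rewrite !mulr_ge0 ?expR_ge0.
have x_le : x <= 1 / h%:R.
  rewrite /x -mulrA mulrCA.
  apply: (@le_trans _ _ (2 * (h%:R * (C / h%:R ^+ 3)))).
    by rewrite ler_pM2l // ler_pM2l // le_C.
  rewrite (_ : 2 * _ = 2 * C / h%:R / h%:R); last by field; rewrite gt_eqF.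
  by rewrite ler_pM2r ?invr_gt0 // ler_pdivrMr // mul1r.
apply: le_trans (x_le); rewrite -{2}[x]expr1 ler_wiXn2l //.
by apply: le_trans x_le _; rewrite ler_pdivrMr // mul1r ler1n.
Qed.

Lemma Pr_strongly_asymmetric_ge : exists (C : R) (N : nat),
  forall h, (N <= h)%N ->
  1 - C / h%:R <= Pr h (@strongly_asymmetric R h).
Proof.
have [C C0 even] := even_rate.
have [C' map] := no_approximate_self_map_rate.
exists (C + (C + (2 + 1))), (maxn 300 (Num.trunc C').+1) => h.
rewrite geq_max => /andP[h300 hC'].
have h0 : (0 < h)%N by lia.
have {hC'}C'h : C' <= h%:R.
  by apply: ltW; apply: lt_le_trans (truncnS_gt _) _; rewrite ler_nat.
have [stars agreements] := even h h0.
have [|Q Qlog sep] := @separates_rate h; first by lia.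
rewrite lerBlDr addrC -lerBlDr -PrC (mulrDl C) (mulrDl C) (mulrDl 2).
apply: le_trans (lerD stars (lerD agreements (lerD sep (map h h0 C'h)))).
apply: (@le_trans _ _ (Pr h (fun H => ~ even_stars H \/ ~ even_agreements H \/
    ~ separates Q H \/ ~ no_approximate_self_map H))).
  apply: Pr_le => H; apply: contra_notP => /not_orP[/contrapT st].
  move=> /not_orP[/contrapT ag] /not_orP[/contrapT se] /contrapT ma; split.
  - by apply: even_stars_degrees => //; lia.
  - exact: even_agreements_small.
  - by exists Q; split=> //; exact: separates_distinguishing.
  - exact: far_from_blowups_typical.
  - exact: far_from_isomorphisms_typical.
by do 3![refine (le_trans (Pr_or _ _ _) _); rewrite ?lerD2l].
Qed.

End Rates.

Local Open Scope classical_set_scope.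
Local Open Scope ring_scope.

Theorem theorem1 (R : realType) :
  (fun h : nat => Pr_Gnp (1 / 2) (@strongly_asymmetric R h)) @ \oo --> (1 : R).
Proof.
have [C [N ge_C]] := Pr_strongly_asymmetric_ge R.
apply/cvgrPdist_le => e e0; near=> h.
have h0 : 0 < h%:R :> R by rewrite ltr0n; near: h; exact: nbhs_infty_ge.
rewrite ger0_norm ?subr_ge0 ?Pr_le1 // lerBlDr -lerBlDl.
apply: (@le_trans _ _ (1 - C / h%:R)); last first.
  by apply: ge_C; near: h; exact: nbhs_infty_ge.
rewrite lerD2l lerN2 ler_pdivrMr // mulrC -ler_pdivrMr //.
by near: h; exact: nbhs_infty_ger.
Unshelve. all: by end_near.
Qed.
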